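(* Let $J$ be the maximal block Jacobi operator (not assumed to be self-adjoint), and for $z\in\mathbb{C}$ let $\mathrm{GEV}_{\ell^2}(z)$ be the space of square-summable generalized eigenvectors for $J$ and $z$. If $z\in\mathbb{C}\setminus\sigma_{p}(J)$, then $\dim \mathrm{GEV}_{\ell^2}(z)\le d$. If, moreover, $z\in\mathbb{C}\setminus\sigma(J)$, then $\dim\mathrm{GEV}_{\ell^2}(z)=d$.
   Context: Let $d\in\mathbb{N}$, $\mathbb{N}_0=\{0,1,2,\dots\}$, and let $(A_n)_{n\ge0},(B_n)_{n\ge 0}$ be sequences in $M_d(\mathbb{C})$ with $\det A_n\ne0$ and $B_n=B_n^*$ for all $n\ge0$. The formal block Jacobi operator acts on all sequences $u=(u_n)_{n\ge0}$ in $\mathbb{C}^d$ by $(\mathcal{J}u)_0=B_0u_0+A_0u_1$, $(\mathcal{J}u)_n=A_{n-1}^*u_{n-1}+B_nu_n+A_nu_{n+1}$ for $n\ge1$. The maximal block Jacobi operator $J$ in the Hilbert space $\ell^2(\mathbb{N}_0,\mathbb{C}^d)$ is the restriction of $\mathcal{J}$ to $\mathrm{Dom}(J)=\{u\in\ell^2(\mathbb{N}_0,\mathbb{C}^d):\mathcal{J}u\in\ell^2(\mathbb{N}_0,\mathbb{C}^d)\}$. $\sigma(J)$ is its spectrum and $\sigma_p(J)$ its set of eigenvalues. For $z\in\mathbb{C}$, $\mathrm{GEV}_{\ell^2}(z)$ is the linear space of all $u\in\ell^2(\mathbb{N}_0,\mathbb{C}^d)$ satisfying $A_{n-1}^*u_{n-1}+B_nu_n+A_nu_{n+1}=zu_n$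 for all $n\ge1$ (no condition is imposed at $n=0$). *)

(* Defs.v *)
From HB Require Import structures.
From mathcomp Require Import all_boot all_order all_algebra.
From mathcomp Require Import spectral sesquilinear complex.
From mathcomp Require Import all_classical all_reals all_analysis.
Set Implicit Arguments.
Unset Strict Implicit.
Unset Printing Implicit Defensive.
Import Order.TTheory GRing.Theory Num.Theory.
Import numFieldNormedType.Exports.
Local Open Scope classical_set_scope.
Local Open Scope sesquilinear_scope.
Local Open Scope ring_scope.

Section Dimension.
Context {F : fieldType} {V : lmodType F}.

(* [S] is a linear subspace with a basis of [n] vectors; the equivalence in
   the last clause forces [S] to be closed under linear combinations. *)
Definition has_dim (S : set V) (n : nat) : Prop :=
  exists e : 'I_n -> V,
    (forall c : 'I_n -> F, \sum_i c i *: e i = 0 -> forall i, c i = 0) /\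
    (forall v, S v <-> exists c : 'I_n -> F, v = \sum_i c i *: e i).

Definition dim_le (S : set V) (n : nat) : Prop :=
  exists2 m : nat, (m <= n)%N & has_dim S m.

End Dimension.

Section EllTwo.
Context {R : realType} {d : nat}.
Local Notation vseq := (nat -> 'cV[R[i]]_d).

Definition sqnorm (v : 'cV[R[i]]_d) : R := \sum_(i < d) Normc.normc (v i 0) ^+ 2.

Definition l2 : set vseq := [set u | cvgn (series (fun n => sqnorm (u n)))].

(* Meaningful only on [l2]. *)
Definition l2norm (u : vseq) : R :=
  Num.sqrt (limn (series (fun n => sqnorm (u n)))).

(* For a possibly unbounded operator [T] in [l2] with domain [D]: the second
   clause is the boundedness of the inverse of [T - z]. *)
Definition resolvent_set (D : set vseq) (T : vseq -> vseq) : set R[i] :=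
  [set z | set_bij D l2 (fun u => T u - z *: u) /\
           exists M : R, forall u, D u ->
             l2norm u <= M * l2norm (T u - z *: u)].

Definition spectrum (D : set vseq) (T : vseq -> vseq) : set R[i] :=
  ~` resolvent_set D T.

Definition point_spectrum (D : set vseq) (T : vseq -> vseq) : set R[i] :=
  [set z | exists u, [/\ D u, u <> 0 & T u = z *: u]].

End EllTwo.

Section Jacobi.
Context {R : realType} {d : nat} (A B : nat -> 'M[R[i]]_d).
Local Notation vseq := (nat -> 'cV[R[i]]_d).

Definition jacobi (u : vseq) : vseq := fun n =>
  if n is m.+1 then (A m)^t* *m u m + B n *m u n + A n *m u n.+1
  else B 0%N *m u 0%N + A 0%N *m u 1%N.

Definition jacobi_dom : set vseq := [set u | l2 u /\ l2 (jacobi u)].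

Definition gev_l2 (z : R[i]) : set vseq :=
  [set u | l2 u /\ forall n, (1 <= n)%N ->
     (A n.-1)^t* *m u n.-1 + B n *m u n + A n *m u n.+1 = z *: u n].

End Jacobi.

(* Main.v *)
Require Import Defs.
From HB Require Import structures.
From mathcomp Require Import all_boot all_order all_algebra.
From mathcomp Require Import spectral sesquilinear complex.
From mathcomp Require Import all_classical all_reals all_analysis.
From mathcomp Require Import lra.
Import Order.TTheory GRing.Theory Num.Theory.
Import numFieldNormedType.Exports.
Local Open Scope classical_set_scope.
Local Open Scope sesquilinear_scope.
Local Open Scope ring_scope.

(** The row of index 0 is the only one that an element [u] of [GEV(z)] may
    violate, so [jacobi u - z *: u] is the sequence [(L u, 0, 0, ...)], where
    [L u = B_0 u_0 + A_0 u_1 - z u_0] is the boundary defect of [u].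
    - The map [L] is linear from [GEV(z)] to [C^d].
    - If [L u = 0] then [jacobi u = z *: u]; this is square summable, so [u]
      lies in the domain and is an eigenvector unless it vanishes. Hence [L]
      is injective on [GEV(z)] when [z] is not an eigenvalue, and the
      dimension of [GEV(z)] is at most [d] ([boundary_defect_inj]).
    - If [z] lies in the resolvent set, then for each vector [w] the sequence
      [(w, 0, 0, ...)] is [jacobi u - z *: u] for some [u] of the domain, and
      such a [u] belongs to [GEV(z)] with defect [w]. Hence [L] is onto
      ([boundary_defect_surj]); it is also injective, since the resolvent set
      contains no eigenvalue, and so the dimension is exactly [d].
    The passage from [L] to dimensions is [has_dim_of_injective]. *)

(** * Dimension of a subspace embedded in a finite-dimensional space *)

Section DimensionByInjection.
Variables (F : fieldType) (V : lmodType F) (W : vectType F).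
Variables (S : set V) (L : {linear V -> W}).
Hypothesis S0 : S 0.
Hypothesis S_lin : forall a u v, S u -> S v -> S (a *: u + v).
Hypothesis L_inj : forall u, S u -> L u = 0 -> u = 0.

Lemma subspace_sum (n : nat) (e : 'I_n -> V) (c : 'I_n -> F) :
  (forall i, S (e i)) -> S (\sum_i c i *: e i).
Proof. by move=> Se; apply: big_rec => // i v _; exact: S_lin. Qed.

(** Linear relations among the vectors of [S] are detected by [L], so both
    independence and coordinates can be computed in [W]. *)
Lemma has_dim_of_lifted_basis (X : seq V) :
  (forall x, x \in X -> S x) -> free (map L X) ->
  (forall v, S v -> L v \in <<map L X>>%VS) -> has_dim S (size X).
Proof.
move=> SX frX spX.
have L_sum (c : 'I_(size X) -> F) :
    L (\sum_i c i *: X`_i) = \sum_i c i *: (map L X)`_i.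
  rewrite linear_sum; apply: eq_bigr => i _.
  by rewrite linearZ /= (nth_map 0).
have SXi (i : 'I_(size X)) : S X`_i by apply: SX; exact: mem_nth.
exists (fun i => X`_i); split=> [c c0|v].
  move: frX => /(@freeP _ _ _ (map_tuple L (in_tuple X))); apply.
  by rewrite /= -L_sum c0 linear0.
split=> [Sv|[c ->]]; last exact: subspace_sum.
pose c i := coord (map_tuple L (in_tuple X)) i (L v).
exists c; apply/eqP; rewrite -subr_eq0; apply/eqP; apply: L_inj.
  by rewrite addrC -scaleN1r; apply: S_lin => //; exact: subspace_sum.
rewrite linearB /= L_sum; apply/eqP; rewrite subr_eq0; apply/eqP.
exact: (@coord_span _ _ _ (map_tuple L (in_tuple X))) (spX _ Sv).
Qed.

(** The basis is a longest family of [S] with free image: [\dim {:W}] bounds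
    its length, and its image spans [L @` S], as otherwise one more vector
    could be added to it. *)
Lemma has_dim_of_injective : exists m : nat,
  [/\ (m <= \dim {:W})%N, has_dim S m
    & (forall w, exists2 u, S u & L u = w) -> m = \dim {:W}].
Proof.
pose P n := `[< exists X : seq V,
  [/\ size X = n, forall x, x \in X -> S x & free (map L X)] >].
have exP : exists n, P n.
  by exists 0%N; apply/asboolP; exists [::]; split=> //; exact: nil_free.
have leP n : P n -> (n <= \dim {:W})%N.
  move=> /asboolP[X [<- _ /eqP frX]].
  by rewrite -(size_map L) -frX dimvS ?subvf.
case: (ex_maxnP exP leP) => m Pm max_m.
have /asboolP[X [sX SX frX]] := Pm.
have spX v : S v -> L v \in <<map L X>>%VS.
  move=> Sv; apply/negPn/negP => nspv.
  have /max_m : P m.+1; last by rewrite ltnn.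
  apply/asboolP; exists (v :: X); split => /=; first by rewrite sX.
  - by move=> x; rewrite inE => /predU1P[->|/SX].
  - by rewrite free_cons nspv.
exists m; split; [exact: leP | by rewrite -sX; exact: has_dim_of_lifted_basis|].
move=> L_surj; move: (frX); rewrite /free size_map sX => /eqP <-.
congr (\dim _); apply/vspaceP => w; rewrite memvf.
by have [u Su <-] := L_surj w; exact: spX.
Qed.

End DimensionByInjection.

(** * Square-summable sequences *)

Section EllTwoTheory.
Context {R : realType} {d : nat}.
Local Notation vseq := (nat -> 'cV[R[i]]_d).

Lemma sqnorm_ge0 (v : 'cV[R[i]]_d) : 0 <= sqnorm v.
Proof. by apply: sumr_ge0 => i _; exact: sqr_ge0. Qed.

Lemma sqnorm0 : sqnorm (0 : 'cV[R[i]]_d) = 0.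
Proof. by apply: big1 => i _; rewrite mxE Normc.normc0 expr0n. Qed.

(** The triangle inequality and [(s + t)^2 <= 2 s^2 + 2 t^2], entrywise. *)
Lemma sqnorm_lin_le (a : R[i]) (u v : 'cV[R[i]]_d) :
  sqnorm (a *: u + v) <= 2 * Normc.normc a ^+ 2 * sqnorm u + 2 * sqnorm v.
Proof.
rewrite /sqnorm !mulr_sumr -big_split /=; apply: ler_sum => i _.
rewrite !mxE.
have := le_normcD (a * u i 0) (v i 0); rewrite Normc.normcM.
set s := Normc.normc _ => le_s.
have s0 : 0 <= s by rewrite /s; case: (_ + _) => x y; exact: sqrtr_ge0.
set p := Normc.normc a in le_s *; set q := Normc.normc _ in le_s *.
set r := Normc.normc _ in le_s *.
have : s ^+ 2 <= (p * q + r) ^+ 2 by rewrite ler_sqr ?nnegrE // (le_trans s0).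
have := sqr_ge0 (p * q - r).
nra.
Qed.

Lemma l2_lin (a : R[i]) (u v : vseq) : l2 u -> l2 v -> l2 (a *: u + v).
Proof.
move=> l2u l2v.
apply: (@series_le_cvg _ _ ((2 * Normc.normc a ^+ 2) *: (fun n => sqnorm (u n))
    + (2 : R) *: (fun n => sqnorm (v n)))).
- by move=> n; exact: sqnorm_ge0.
- by move=> n; apply: addr_ge0; apply: mulr_ge0; rewrite ?sqnorm_ge0 //
    mulr_ge0 ?sqr_ge0.
- by move=> n; exact: sqnorm_lin_le.
- by apply: is_cvg_seriesD; apply: is_cvg_seriesZ.
Qed.

Definition supported_at0 (w : 'cV[R[i]]_d) : vseq :=
  fun n => if n is 0%N then w else 0.

Lemma l2_supported_at0 (w : 'cV[R[i]]_d) : l2 (supported_at0 w).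
Proof.
rewrite /l2 /= -(is_cvg_series_restrict 1); apply: (@is_cvg_near_cst _ _ 0).
apply: nearW => n /=; rewrite big_nat_cond big1 // => -[|k] //= _.
exact: sqnorm0.
Qed.

Lemma l2_0 : l2 (0 : vseq).
Proof.
have := l2_supported_at0 0; congr l2.
by apply/funext => -[|n].
Qed.

End EllTwoTheory.

(** * The boundary defect *)

Section BoundaryDefect.
Context {R : realType} {d : nat} (A B : nat -> 'M[R[i]]_d) (z : R[i]).
Local Notation vseq := (nat -> 'cV[R[i]]_d).

Lemma jacobi_is_linear : linear (jacobi A B).
Proof.
move=> a u v; apply/funext => -[|n] /=;
  rewrite !fctE /= !mulmxDr -!scalemxAr !scalerDr; first by rewrite addrACA.
by rewrite [X in X + _ = _]addrACA [LHS]addrACA.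
Qed.

HB.instance Definition _ := GRing.isLinear.Build R[i] vseq vseq
  *:%R (jacobi A B) jacobi_is_linear.

Definition boundary_defect (u : vseq) : 'cV[R[i]]_d :=
  jacobi A B u 0%N - z *: u 0%N.

Lemma boundary_defect_is_linear : linear boundary_defect.
Proof.
move=> a u v; rewrite /boundary_defect jacobi_is_linear !fctE.
by rewrite !scalerDr scalerN !scalerA [z * a]mulrC opprD addrACA.
Qed.

HB.instance Definition _ := GRing.isLinear.Build R[i] vseq 'cV[R[i]]_d
  *:%R boundary_defect boundary_defect_is_linear.

(** Trades the recurrence at positive indices for one equation between
    sequences, in which linearity and square summability apply globally. *)
Lemma gev_l2P (u : vseq) : gev_l2 A B z u <->
  l2 u /\ jacobi A B u = z *: u + supported_at0 (boundary_defect u).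
Proof.
split=> [[l2u gev]|[l2u Ju]]; split=> //.
  apply/funext => -[|n]; first by rewrite !fctE /= addrC subrK.
  by rewrite !fctE /= addr0; exact: (gev n.+1).
by case=> // n _; have := congr1 (@^~ n.+1) Ju; rewrite !fctE /= addr0.
Qed.

Lemma gev_l2_0 : gev_l2 A B z 0.
Proof.
apply/gev_l2P; split; first exact: l2_0.
by rewrite !linear0 add0r; apply/funext => -[|n].
Qed.

Lemma gev_l2_lin (a : R[i]) (u v : vseq) :
  gev_l2 A B z u -> gev_l2 A B z v -> gev_l2 A B z (a *: u + v).
Proof.
move=> /gev_l2P[l2u Ju] /gev_l2P[l2v Jv]; apply/gev_l2P; split.
  exact: l2_lin.
rewrite jacobi_is_linear boundary_defect_is_linear Ju Jv.
apply/funext => -[|n]; rewrite !fctE /= !scalerDr !scalerA [z * a]mulrC.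
  by rewrite addrACA.
by rewrite scaler0 !addr0.
Qed.

(** A vanishing defect restores the missing row, so [u] solves the full
    eigenvalue equation; [jacobi u], a multiple of [u], is then square summable,
    which is what membership in the domain requires. *)
Lemma boundary_defect_inj :
  ~ point_spectrum (jacobi_dom A B) (jacobi A B) z ->
  forall u, gev_l2 A B z u -> boundary_defect u = 0 -> u = 0.
Proof.
move=> nev u /gev_l2P[l2u Ju] Lu0; apply: contrapT => u0; apply: nev.
have {}Ju : jacobi A B u = z *: u.
  by rewrite Ju Lu0; apply/funext => -[|n]; rewrite !fctE /= addr0.
exists u; split=> //; split=> //=; rewrite Ju -[z *: u]addr0.
by apply: l2_lin => //; exact: l2_0.
Qed.

(** The preimage under [jacobi - z] of a sequence supported at index 0
    satisfies every row of the eigenvalue equation but the first. *)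
Lemma boundary_defect_surj :
  resolvent_set (jacobi_dom A B) (jacobi A B) z ->
  forall w, exists2 u, gev_l2 A B z u & boundary_defect u = w.
Proof.
move=> [[_ _ surj] _] w.
have [u [l2u _] Ju] := surj _ (l2_supported_at0 w).
have Lu : boundary_defect u = w by have := congr1 (@^~ 0%N) Ju.
exists u => //; apply/gev_l2P; split=> //.
by rewrite Lu -Ju addrC subrK.
Qed.

Lemma resolvent_not_eigenvalue :
  resolvent_set (jacobi_dom A B) (jacobi A B) z ->
  ~ point_spectrum (jacobi_dom A B) (jacobi A B) z.
Proof.
move=> [[_ inj _] _] [u [Du u0 Ju]]; apply: u0.
apply: inj; rewrite ?inE //; first by split=> /=; rewrite ?linear0; exact: l2_0.
by rewrite Ju linear0 scaler0 !subrr.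
Qed.

End BoundaryDefect.

Theorem theorem5p7 (R : realType) (d : nat) (hd : (0 < d)%N)
    (A B : nat -> 'M[R[i]]_d)
    (hA : forall n, \det (A n) <> 0)
    (hB : forall n, B n = (B n)^t*)
    (z : R[i]) :
  (~ point_spectrum (jacobi_dom A B) (jacobi A B) z ->
     dim_le (gev_l2 A B z) d) /\
  (~ spectrum (jacobi_dom A B) (jacobi A B) z ->
     has_dim (gev_l2 A B z) d).
Proof.
have dimCd : \dim {:'cV[R[i]]_d} = d by rewrite dimvf dim_matrix mulr1.
split=> [nev|/contrapT res].
  have [m [le_m dim_m _]] := has_dim_of_injective _ _ _ (gev_l2 A B z)
    (boundary_defect A B z) (gev_l2_0 A B z) (gev_l2_lin A B z)
    (boundary_defect_inj A B z nev).
  by exists m; rewrite // -dimCd.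
have [m [_ dim_m eq_m]] := has_dim_of_injective _ _ _ (gev_l2 A B z)
  (boundary_defect A B z) (gev_l2_0 A B z) (gev_l2_lin A B z)
  (boundary_defect_inj A B z (resolvent_not_eigenvalue A B z res)).
have eq_md : m = d.
  by rewrite -dimCd; apply: eq_m; exact: boundary_defect_surj.
by move: dim_m; rewrite eq_md.
Qed.
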